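(* The category $\mathbf{LSS}$ of locally small generalized topological spaces and strictly continuous mappings is finitely complete (it has all finite limits).
   Context: For a family of sets $\mathcal U$ and a set $V$, $V\underline{\cap}\,\mathcal U=\{V\cap U: U\in\mathcal U\}$. For a set $\Phi$ of families of sets, $\underline{\bigcup}\Phi=\{\bigcup\mathcal U:\mathcal U\in\Phi\}$. $\mathcal U\preceq\mathcal V$ means that $\bigcup\mathcal U=\bigcup\mathcal V$ and every member of $\mathcal U$ is contained in some member of $\mathcal V$. A generalized topological space (gts) is a triple $(M,Op_M,Cov_M)$, where $M$ is a set, $Op_M\subseteq\mathcal P(M)$ (the open sets) and $Cov_M\subseteq\mathcal P(Op_M)$ (the admissible families), such that: (finiteness) if $\mathcal U$ is a finite subfamily of $Op_M$, then $\bigcup\mathcal U,\bigcap\mathcal U\in Op_M$ (with $\bigcup\emptyset=\emptyset$, $\bigcap\emptyset=M$) and $\mathcal U\in Cov_M$; (stability) if $V\in Op_M$ and $\mathcal U\in Cov_M$, then $V\underline{\cap}\,\mathcal U\in Cov_M$; (transitivity) if $\Phi\subseteq Cov_M$ and $\underline{\bigcup}\Phi\in Cov_M$, then $\bigcup\Phi\in Cov_M$; (saturation) if $\mathcal U\in Cov_M$, $\mathcal V\subseteq Op_M$ and $\mathcal U\preceq\mathcal V$, then $\mathcal V\in Cov_M$; (regularity) if $W\subseteq M$, $\mathcal U\in Cov_M$ and $W\underline{\cap}\,\mathcal U\subseteq Op_M$, then $W\cap\bigcup\mathcal U\in Op_M$. A mapping between gtses is strictly continuous if the preimage $\{f^{-1}(U):U\in\mathcal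 U\}$ of every admissible family $\mathcal U$ is an admissible family. $\mathbf{GTS}$ is the category of gtses and strictly continuous mappings. A subset $K$ of a gts $X$ is small if for every admissible family $\mathcal U$, the set $K\cap\bigcup\mathcal U$ is covered by finitely many members of $\mathcal U$. A gts $X$ is locally small if there is an admissible family of small open subsets of $X$ whose union is $X$. $\mathbf{LSS}$ is the full subcategory of $\mathbf{GTS}$ whose objects are the locally small gtses. *)

(* Defs.v *)
From mathcomp Require Import all_boot.
From mathcomp Require Import boolp classical_sets functions cardinality.

Set Implicit Arguments.
Unset Strict Implicit.
Unset Printing Implicit Defensive.

Local Open Scope classical_set_scope.

Record category := Category {
  obj : Type;
  hom : obj -> obj -> Type;
  idc : forall a, hom a a;
  comp : forall a b c, hom b c -> hom a b -> hom a c;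
  comp_idl : forall a b (f : hom a b), comp (idc b) f = f;
  comp_idr : forall a b (f : hom a b), comp f (idc a) = f;
  compA : forall a b c d (h : hom c d) (g : hom b c) (f : hom a b),
    comp h (comp g f) = comp (comp h g) f }.

Arguments hom {c} a b : rename.
Arguments idc {c} a : rename.
Arguments comp {c a b c0} g f : rename.

Record functor (J C : category) := Functor {
  fobj : obj J -> obj C;
  fmap : forall a b, hom a b -> hom (fobj a) (fobj b);
  fmap_id : forall a, fmap (idc a) = idc (fobj a);
  fmap_comp : forall a b c (g : hom b c) (f : hom a b),
    fmap (comp g f) = comp (fmap g) (fmap f) }.

Record cone (J C : category) (F : functor J C) := Cone {
  apex : obj C;
  leg : forall j, hom apex (fobj F j);
  leg_natural : forall i j (u : hom i j), comp (fmap F u) (leg i) = leg j }.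

Definition is_limit (J C : category) (F : functor J C) (L : cone F) : Prop :=
  forall K : cone F,
    exists! h : hom (apex K) (apex L), forall j, comp (leg L j) h = leg K j.

Definition finite_category (J : category) : Prop :=
  finite_set [set: obj J] /\ forall a b : obj J, finite_set [set: hom a b].

Definition finitely_complete (C : category) : Prop :=
  forall J : category, finite_category J ->
  forall F : functor J C, exists L : cone F, is_limit L.

Definition full_subcategory (C : category) (P : obj C -> Prop) : category :=
  @Category {a : obj C | P a}
    (fun a b => hom (sval a) (sval b))
    (fun a => idc (sval a))
    (fun a b c g f => comp g f)
    (fun a b f => comp_idl f)
    (fun a b f => comp_idr f)
    (fun a b c d h g f => compA h g f).

Definition union {T : Type} (U : set (set T)) : set T := \bigcup_(A in U) A.

Definition inter {T : Type} (U : set (set T)) : set T := \bigcap_(A in U) A.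

Definition trace {T : Type} (V : set T) (U : set (set T)) : set (set T) :=
  [set V `&` A | A in U].

Definition refines {T : Type} (U V : set (set T)) : Prop :=
  union U = union V /\ forall A, U A -> exists2 B, V B & A `<=` B.

Record gts := Gts {
  carrier :> Type;
  Op : set (set carrier);
  Cov : set (set (set carrier));
  Cov_Op : forall U, Cov U -> U `<=` Op;
  gts_finiteness : forall U, finite_set U -> U `<=` Op ->
    [/\ Op (union U), Op (inter U) & Cov U];
  gts_stability : forall V U, Op V -> Cov U -> Cov (trace V U);
  gts_transitivity : forall Phi : set (set (set carrier)),
    Phi `<=` Cov -> Cov [set union U | U in Phi] ->
    Cov (\bigcup_(U in Phi) U);
  gts_saturation : forall U V, Cov U -> V `<=` Op -> refines U V -> Cov V;
  gts_regularity : forall W U,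
    Cov U -> trace W U `<=` Op -> Op (W `&` union U) }.

Arguments Op : clear implicits.
Arguments Cov : clear implicits.

Definition preimage_family {S T : Type} (f : S -> T) (U : set (set T)) :
  set (set S) := [set f @^-1` A | A in U].

Definition strictly_continuous (X Y : gts) (f : X -> Y) : Prop :=
  forall U, Cov Y U -> Cov X (preimage_family f U).

Lemma strictly_continuous_id (X : gts) : @strictly_continuous X X id.
Proof. by move=> U CU; rewrite /preimage_family (image_id U). Qed.

Lemma strictly_continuous_comp (X Y Z : gts) (g : Y -> Z) (f : X -> Y) :
  strictly_continuous g -> strictly_continuous f ->
  strictly_continuous (g \o f).
Proof.
by move=> cg cf U /cg /cf; rewrite /preimage_family image_comp.
Qed.

Definition smap (X Y : gts) : Type := {f : X -> Y | strictly_continuous f}.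

Definition smap_id (X : gts) : smap X X := exist _ id (@strictly_continuous_id X).

Definition smap_comp (X Y Z : gts) (g : smap Y Z) (f : smap X Y) : smap X Z :=
  exist _ (sval g \o sval f)
    (strictly_continuous_comp (svalP g) (svalP f)).

Lemma smap_comp_idl (X Y : gts) (f : smap X Y) : smap_comp (smap_id Y) f = f.
Proof. by case: f => f cf; apply: eq_exist. Qed.

Lemma smap_comp_idr (X Y : gts) (f : smap X Y) : smap_comp f (smap_id X) = f.
Proof. by case: f => f cf; apply: eq_exist. Qed.

Lemma smap_compA (X Y Z T : gts) (h : smap Z T) (g : smap Y Z) (f : smap X Y) :
  smap_comp h (smap_comp g f) = smap_comp (smap_comp h g) f.
Proof. exact: eq_exist. Qed.

Definition GTS : category :=
  Category smap_comp_idl smap_comp_idr smap_compA.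

Definition small (X : gts) (K : set X) : Prop :=
  forall U, Cov X U ->
    exists V, [/\ finite_set V, V `<=` U & K `&` union U `<=` union V].

(* Members of an admissible family are open by [Cov_Op]. *)
Definition locally_small (X : gts) : Prop :=
  exists U, [/\ Cov X U, forall A, U A -> small A & union U = [set: X]].

Definition LSS : category := @full_subcategory GTS locally_small.

(* Main.v *)
From mathcomp Require Import all_boot.
From mathcomp Require Import boolp classical_sets functions cardinality.
Require Import Defs.

(** The limit of a finite diagram of locally small spaces is computed as in
    the category of all generalized topological spaces: its points are the
    compatible families of points, with the initial structure for the
    projections; what has to be seen is that this structure is again locally
    small.

    The initial structure on [T] for maps [p i : T -> X i] is described through
    its plots, the maps [g : Y -> T] from a space [Y] for which all
    [p i \o g] are strictly continuous: a family is admissible when every plot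
    pulls it back to an admissible family. Each axiom is inherited from the
    spaces [Y], because pulling back commutes with unions, intersections and
    traces, and the universal property ([initial_universal]) is then
    immediate.

    Smallness comes from testing against one well-chosen plot. Given a subset
    [K] of a space, the admissible families that need only finitely many
    members to cover [K] are the admissible families of a second structure
    with the same open sets ([trimmed]). Trim the initial structure along [K].
    If each [p i] sends [K] into a small set, then the projections stay
    strictly continuous, so the identity from the trimmed space is a plot.
    Hence every admissible family of the initial structure is admissible in
    the trimmed one, which says that [K] is small ([initial_small]).

    It remains to cover [T] admissibly by sets that every [p i] sends into a
    small set. Each [p i] pulls an admissible cover of [X i] by small sets back
    to an admissible cover of [T]; since the diagram is finite, finitely many
    common refinements ([admissible_coverI]) suffice
    ([initial_locally_small]). *)

Set Implicit Arguments.
Unset Strict Implicit.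
Unset Printing Implicit Defensive.

Local Open Scope classical_set_scope.

(** * Families of sets and inverse images *)

Lemma union_preimage_family (S T : Type) (f : S -> T) (U : set (set T)) :
  union (preimage_family f U) = f @^-1` union U.
Proof. by rewrite /union /preimage_family bigcup_image preimage_bigcup. Qed.

Lemma inter_preimage_family (S T : Type) (f : S -> T) (U : set (set T)) :
  inter (preimage_family f U) = f @^-1` inter U.
Proof. by rewrite /inter /preimage_family bigcap_image preimage_bigcap. Qed.

Lemma trace_preimage_family (S T : Type) (f : S -> T) V (U : set (set T)) :
  trace (f @^-1` V) (preimage_family f U) = preimage_family f (trace V U).
Proof. by rewrite /trace /preimage_family !image_comp. Qed.

Lemma union_trace (T : Type) (V : set T) (U : set (set T)) :
  union (trace V U) = V `&` union U.
Proof. by rewrite /union /trace bigcup_image setI_bigcupr. Qed.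

Lemma image_bigcup_id (S T : Type) (f : S -> T) (Phi : set (set S)) :
  f @` (\bigcup_(U in Phi) U) =
  \bigcup_(V in [set f @` U | U in Phi]) V.
Proof. by rewrite image_bigcup bigcup_image. Qed.

Lemma refines_preimage_family (S T : Type) (f : S -> T) (U V : set (set T)) :
  refines U V -> refines (preimage_family f U) (preimage_family f V).
Proof.
move=> [eUV subUV]; split; first by rewrite !union_preimage_family eUV.
move=> _ [A UA <-]; have [B VB AB] := subUV A UA.
by exists (f @^-1` B); [exists B | move=> x /AB].
Qed.

Lemma Cov_set1 (X : gts) (A : set X) : Op X A -> Cov X [set A].
Proof.
move=> OA; have [] // := @gts_finiteness X [set A].
by move=> _ ->.
Qed.

Lemma smap_eq (X Y : gts) (f g : smap X Y) : sval f =1 sval g -> f = g.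
Proof.
by case: f g => [f cf] [g cg] /= fg; apply: eq_exist; exact: funext.
Qed.

(** * The initial structure *)

Section Initial.
Variables (I T : Type) (X : I -> gts) (p : forall i, T -> X i).

Definition plot (K : gts) (g : K -> T) : Prop :=
  forall i, strictly_continuous (p i \o g).

(** Plots serve in place of an intersection of all structures making the
    [p i] strictly continuous: quantifying over them keeps the carrier equal
    to [T] and involves no equality between carriers. *)
Definition initial_Op : set (set T) :=
  [set A | forall (K : gts) (g : K -> T), plot g -> Op K (g @^-1` A)].

Definition initial_Cov : set (set (set T)) :=
  [set U | forall (K : gts) (g : K -> T),
    plot g -> Cov K (preimage_family g U)].

Lemma preimage_initial_Op (K : gts) (g : K -> T) (U : set (set T)) :
  plot g -> U `<=` initial_Op -> preimage_family g U `<=` Op K.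
Proof. by move=> pg UO _ [A /UO OA <-]; exact: OA. Qed.

Lemma initial_Cov_Op U : initial_Cov U -> U `<=` initial_Op.
Proof. by move=> CU A UA K g /CU/Cov_Op; apply; exists A. Qed.

Lemma initial_finiteness U : finite_set U -> U `<=` initial_Op ->
  [/\ initial_Op (union U), initial_Op (inter U) & initial_Cov U].
Proof.
move=> finU UO.
have fin K g : plot g -> [/\ Op K (g @^-1` union U), Op K (g @^-1` inter U)
    & Cov K (preimage_family g U)].
  move=> pg; rewrite -union_preimage_family -inter_preimage_family.
  apply: gts_finiteness; first exact: finite_image.
  exact: preimage_initial_Op.
by split=> K g /fin[].
Qed.

Lemma initial_stability V U :
  initial_Op V -> initial_Cov U -> initial_Cov (trace V U).
Proof.
move=> OV CU K g pg; rewrite -trace_preimage_family.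
by apply: gts_stability; [exact: OV | exact: CU].
Qed.

(** Transitivity in [K] is applied to the set of pulled back families
    [preimage_family g U], for [U] in [Phi]. *)
Lemma initial_transitivity (Phi : set (set (set T))) :
  Phi `<=` initial_Cov -> initial_Cov [set union U | U in Phi] ->
  initial_Cov (\bigcup_(U in Phi) U).
Proof.
move=> PhiC CPhi K g pg; rewrite /preimage_family image_bigcup_id.
apply: gts_transitivity; first by move=> _ [U /PhiC CU <-]; exact: CU.
have := CPhi K g pg; rewrite /preimage_family !image_comp.
congr (Cov K _); apply: eq_imagel => U _ /=.
by rewrite -union_preimage_family.
Qed.

Lemma initial_saturation U V : initial_Cov U -> V `<=` initial_Op ->
  refines U V -> initial_Cov V.
Proof.
move=> CU VO UV K g pg.
apply: (gts_saturation (CU K g pg)); first exact: preimage_initial_Op.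
exact: refines_preimage_family.
Qed.

Lemma initial_regularity W U : initial_Cov U -> trace W U `<=` initial_Op ->
  initial_Op (W `&` union U).
Proof.
move=> CU WUO K g pg; rewrite preimage_setI -union_preimage_family.
apply: gts_regularity; first exact: CU.
by rewrite trace_preimage_family; exact: preimage_initial_Op.
Qed.

Definition initial_gts : gts :=
  Gts initial_Cov_Op initial_finiteness initial_stability
    initial_transitivity initial_saturation initial_regularity.

Lemma initial_continuous i : @strictly_continuous initial_gts (X i) (p i).
Proof.
move=> U CU K g pg; rewrite /preimage_family image_comp.
exact: (pg i U CU).
Qed.

Lemma initial_universal (K : gts) (g : K -> T) :
  plot g -> @strictly_continuous K initial_gts g.
Proof. by move=> pg U; apply. Qed.

End Initial.

(** * Trimming a space along a subset *)

Definition finite_on {T : Type} (K : set T) (U : set (set T)) : Prop :=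
  exists V, [/\ finite_set V, V `<=` U & K `&` union U `<=` union V].

Section Trimmed.
Variables (X : gts) (K : set X).

(** This is the largest structure contained in that of [X] for which [K] is
    small. *)
Definition trimmed_Cov : set (set (set X)) :=
  [set U | Cov X U /\ finite_on K U].

Lemma trimmed_Cov_Op U : trimmed_Cov U -> U `<=` Op X.
Proof. by move=> [/Cov_Op]. Qed.

Lemma trimmed_finiteness U : finite_set U -> U `<=` Op X ->
  [/\ Op X (union U), Op X (inter U) & trimmed_Cov U].
Proof.
move=> finU UO; have [OU OI CU] := gts_finiteness finU UO.
by split=> //; split=> //; exists U; split=> // x [].
Qed.

Lemma trimmed_stability V U :
  Op X V -> trimmed_Cov U -> trimmed_Cov (trace V U).
Proof.
move=> OV [CU [F [finF FU KF]]]; split; first exact: gts_stability.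
exists (trace V F); split; first exact: finite_image.
  exact: image_subset.
by rewrite !union_trace => x [Kx [Vx Ux]]; split=> //; apply: KF.
Qed.

(** Finitely many of the unions [union U], with [U] in [Phi], cover [K], and
    each of them meets [K] in a part covered by finitely many members of
    [U]. *)
Lemma trimmed_transitivity (Phi : set (set (set X))) :
  Phi `<=` trimmed_Cov ->
  trimmed_Cov [set union U | U in Phi] ->
  trimmed_Cov (\bigcup_(U in Phi) U).
Proof.
move=> PhiC [CPhi [F [finF FPhi KF]]]; split.
  by apply: gts_transitivity => // U /PhiC[].
(* The implication sits under the quantifier so that [choice] applies to a
   function defined on all sets [B]. *)
have local (B : set X) : exists G, F B ->
    [/\ finite_set G, G `<=` \bigcup_(U in Phi) U & K `&` B `<=` union G].
  have [FB|nFB] := pselect (F B); last by exists set0.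
  have [U PhiU <-] := FPhi B FB; have [_ [G [finG GU KG]]] := PhiC U PhiU.
  by exists G => _; split=> // A /GU UA; exists U.
have [G GP] := choice local.
exists (\bigcup_(B in F) G B); split.
- by apply: bigcup_finite => // B /GP[].
- by move=> A [B FB GA]; have [_ + _] := GP B FB; apply.
move=> x [Kx [A [U PhiU UA] Ax]].
have [|B FB Bx] := KF x.
  by split=> //; exists (union U); [exists U | exists A].
have [_ _ KG] := GP B FB; have [//|C GC Cx] := KG x.
by exists C => //; exists B.
Qed.

Lemma trimmed_saturation U V : trimmed_Cov U ->
  V `<=` Op X -> refines U V -> trimmed_Cov V.
Proof.
move=> [CU [F [finF FU KF]]] VO UV; split; first exact: gts_saturation UV.
case: UV => eUV subUV.
have larger (A : set X) : exists B, U A -> V B /\ A `<=` B.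
  have [/subUV[B VB AB]|nUA] := pselect (U A); first by exists B.
  by exists set0.
have [h hP] := choice larger.
exists (h @` F); split; first exact: finite_image.
  by move=> _ [A /FU/hP[VA _] <-].
rewrite -eUV => x /KF[A FA Ax].
by exists (h A); [exists A | have [_] := hP A (FU A FA); apply].
Qed.

Lemma trimmed_regularity W U : trimmed_Cov U ->
  trace W U `<=` Op X -> Op X (W `&` union U).
Proof. by move=> [CU _]; exact: gts_regularity. Qed.

Definition trimmed : gts :=
  Gts trimmed_Cov_Op trimmed_finiteness trimmed_stability
    trimmed_transitivity trimmed_saturation
    trimmed_regularity.

End Trimmed.

(** * Local smallness of the initial structure *)

(** The smallness of the sets containing the [p i @` K] is exactly what makes
    the identity from the trimming along [K] a plot, and the initial structure
    has only families that survive being pulled back along plots. *)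
Lemma initial_small (I T : Type) (X : I -> gts) (p : forall i, T -> X i)
    (K : set T) :
  (forall i, exists2 S, small S & K `<=` p i @^-1` S) ->
  @small (initial_gts p) K.
Proof.
move=> Ksmall U CU.
have pl : @plot _ _ _ p (@trimmed (initial_gts p) K) id.
  move=> i V CV; split; first exact: initial_continuous CV.
  have [S smallS KS] := Ksmall i; have [F [finF FV SF]] := smallS V CV.
  exists (preimage_family (p i) F); split; first exact: finite_image.
    exact: image_subset.
  by rewrite !union_preimage_family => x [/KS Sx Vx]; apply: SF.
by have := CU _ _ pl; rewrite /preimage_family (image_id U) => -[].
Qed.

Definition admissible_cover (X : gts) (P : set X -> Prop) : Prop :=
  exists U, [/\ Cov X U, U `<=` P & union U = [set: X]].

Lemma admissible_coverT (X : gts) : admissible_cover [set: set X].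
Proof.
exists [set [set: X]]; split=> //; last exact: bigcup_set1.
apply: Cov_set1; have [] // := @gts_finiteness X set0.
by rewrite /inter bigcap_set0.
Qed.

(** The traces of a cover [V] on the members of a cover [U] form a common
    refinement. It is admissible by transitivity: each trace is admissible by
    stability, and, as [V] covers the space, the unions of these traces are
    exactly the members of [U]. *)
Lemma admissible_coverI (X : gts) (P Q : set (set X)) :
  (forall A B, P A -> B `<=` A -> P B) ->
  (forall A B, Q A -> B `<=` A -> Q B) ->
  admissible_cover P -> admissible_cover Q -> admissible_cover (P `&` Q).
Proof.
move=> downP downQ [U [CU UP UT]] [V [CV VQ VT]].
have eU : [set union W | W in [set trace A V | A in U]] = U.
  rewrite image_comp -[RHS]image_id; apply: eq_imagel => A _ /=.
  by rewrite union_trace VT setIT.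
exists (\bigcup_(W in [set trace A V | A in U]) W); split.
- apply: gts_transitivity; last by rewrite eU.
  by move=> _ [A UA <-]; apply: gts_stability => //; apply: Cov_Op UA.
- move=> _ [_ [A UA <-] [B VB <-]]; split.
    exact: downP (UP A UA) (@subIsetl _ _ _).
  exact: downQ (VQ B VB) (@subIsetr _ _ _).
rewrite -subTset => x _.
have : union U x by rewrite UT.
have : union V x by rewrite VT.
move=> [B VB Bx] [A UA Ax]; exists (A `&` B) => //.
by exists (trace A V); [exists A | exists B].
Qed.

Lemma admissible_cover_finite (X : gts) (P : nat -> set (set X)) n :
  (forall k A B, P k A -> B `<=` A -> P k B) ->
  (forall k, admissible_cover (P k)) ->
  admissible_cover [set A | forall k, (k < n)%N -> P k A].
Proof.
move=> downP covP; elim: n => [|n IHn].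
  by have [U [CU _ UT]] := admissible_coverT X; exists U.
have down A B : (forall k, (k < n)%N -> P k A) -> B `<=` A ->
    forall k, (k < n)%N -> P k B.
  by move=> PA BA k /PA/downP; apply.
have [U [CU UP UT]] := admissible_coverI down (@downP n) IHn (covP n).
exists U; split=> // A /UP[PA PnA] k; rewrite ltnS leq_eqVlt.
by case/predU1P => [->|/PA].
Qed.

(** Finiteness of [I] takes the form of an injective numbering [c] below [n],
    so that common refinements can be taken by induction on [n]. *)
Lemma initial_locally_small (I T : Type) (X : I -> gts)
    (p : forall i, T -> X i) (n : nat) (c : I -> nat) :
  (forall i, (c i < n)%N) -> injective c ->
  (forall i, locally_small (X i)) -> locally_small (initial_gts p).
Proof.
move=> cn cI Xls.
(* Numbers [k] that are not codes impose no condition. *)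
pose P k := [set A : set T | forall i, c i = k ->
  exists2 S, small S & A `<=` p i @^-1` S].
have downP k (A B : set T) : P k A -> B `<=` A -> P k B.
  move=> PA BA i /PA[S smallS AS]; exists S => //.
  exact: subset_trans BA AS.
have covP k : @admissible_cover (initial_gts p) (P k).
  have [[i <-]|nk] := pselect (exists i, c i = k); last first.
    have [U [CU _ UT]] := admissible_coverT (initial_gts p).
    by exists U; split=> // A _ i ik; case: nk; exists i.
  have [U [CU Usmall UT]] := Xls i.
  exists (preimage_family (p i) U); split; first exact: initial_continuous.
    by move=> _ [S US <-] _ /cI->; exists S => //; exact: Usmall.
  by rewrite union_preimage_family UT.
have [U [CU UP UT]] := @admissible_cover_finite (initial_gts p) P n downP covP.
exists U; split=> // A /UP PA; apply: initial_small => i.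
exact: (PA _ (cn i) i).
Qed.

(** * Limits *)

(** The type of all families [forall i, X i] lives in a universe at least that
    of [I], whereas the points of a space must live in the universe of carriers,
    and the objects of a diagram of spaces may lie above it. Restricting the
    families to codes in [D] gives a type [T] in the universe of [D] and the
    [X i]. Elements of [T] carry the mere existence of the family [y] they come
    from; choosing it defines the projections without transport along equations
    between indices. *)
Lemma reindexed_families (I D : Type) (c : I -> D) (X : I -> Type)
    (Q : (forall i, X i) -> Prop) :
  injective c ->
  exists (T : Type) (p : forall i, T -> X i),
    (forall t, Q (p^~ t)) /\
    (forall y, Q y -> exists! t, forall i, p i t = y i).
Proof.
move=> cI.
pose D' := {k : D | exists i, c i = k}.
pose e (k : D') : I := projT1 (cid (svalP k)).
have eK i : exists k, e k = i.
  have ci : exists i', c i' = c i by exists i.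
  by exists (exist _ (c i) ci); apply: cI; rewrite /e; case: cid.
pose T := {x : forall k, X (e k) | exists2 y, Q y & forall k, x k = y (e k)}.
pose lift (t : T) := cid2 (svalP t).
pose p i (t : T) : X i := s2val (lift t) i.
have pE (t : T) k : sval t k = p (e k) t by exact: (s2valP' (lift t)).
exists T, p; split=> [t|y Qy]; first exact: (s2valP (lift t)).
have yx : exists2 y', Q y' & forall k, y (e k) = y' (e k) by exists y.
exists (exist _ (fun k => y (e k)) yx); split.
  by move=> i; have [k <-] := eK i; rewrite -pE.
move=> [x xy] tE; apply: eq_exist; apply: functional_extensionality_dep => k.
by have /= -> := pE (exist _ x xy) k; rewrite tE.
Qed.

Lemma finite_type_code (I : Type) : finite_set [set: I] ->
  exists n (c : I -> nat), (forall i, (c i < n)%N) /\ injective c.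
Proof.
move=> [n /card_set_bijP[c [cn cI _]]]; exists n, c; split.
  by move=> i; apply: (cn i).
by move=> i j; apply: cI; rewrite inE.
Qed.

Theorem theorem4p15 : finitely_complete LSS.
Proof.
move=> J [finJ _] F; have [n [c [cn cI]]] := finite_type_code finJ.
pose X (j : obj J) : gts := sval (fobj F j).
pose F' (i j : obj J) (u : hom i j) : X i -> X j := sval (fmap F u).
have [T [p [pF Tlim]]] := @reindexed_families _ _ c X
  (fun y => forall i j (u : hom i j), F' i j u (y i) = y j) cI.
have Lls : locally_small (initial_gts p).
  exact: (@initial_locally_small _ _ X p n c cn cI (fun j => svalP (fobj F j))).
pose L : obj LSS := exist _ (initial_gts p) Lls.
pose pl j : hom L (fobj F j) := exist _ (p j) (@initial_continuous _ _ _ p j).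
have pl_natural i j (u : hom i j) : comp (fmap F u) (pl i) = pl j.
  by apply: smap_eq => t; exact: pF.
exists (Cone pl_natural) => K.
have legF z i j (u : hom i j) : F' i j u (sval (leg K i) z) = sval (leg K j) z.
  by rewrite -(leg_natural K u).
have [h hP] := choice (fun z => Tlim (fun j => sval (leg K j) z) (legF z)).
have hc : @strictly_continuous (sval (apex K)) (initial_gts p) h.
  apply: initial_universal => j.
  suff -> : p j \o h = sval (leg K j) by exact: (svalP (leg K j)).
  by apply: funext => z; have [+ _] := hP z; apply.
exists (exist _ h hc); split=> [j|h' h'P]; apply: smap_eq => z /=.
  by have [+ _] := hP z; apply.
have [_ +] := hP z; apply => j.
by rewrite -h'P.
Qed.
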